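(* Let $q$ be an odd prime power, $p$ its characteristic, and let $1\le n\le q^2-2$. Write $n=u+vq$ with $0\le u,v\le q-1$, and write $3n\equiv u'+v'q\pmod{q^2-1}$ with $0\le u',v'\le q-1$ and $u'+v'q>0$. Then in $\mathbb F_q$ (integers interpreted in $\mathbb F_p$, and $2^{-1}$ the inverse of $2$ in $\mathbb F_p$), \[ \sum_{a\in\mathbb F_q}D_n(1,a)^3=3(-\delta_n-\mathrm{I}-\mathrm{II}+\mathrm{III})+ \begin{cases}\displaystyle -2^{-u'-v'}\binom{u'+v'}{q-1}+\binom{2(q-1)-u'-v'}{q-1-u'}&\text{if } 1\le u'+v'q\le q^2-2,\\[2mm] -1&\text{if } u'+v'q=q^2-1,\end{cases} \] where $\mathrm{I},\mathrm{II},\mathrm{III}$ are defined (in terms of $u,v,q$) as follows, all sums being over integers in the indicated ranges: \[ \mathrm{I}=\sum_{\max\{-1,\,v-q+\frac{u+v}{q-1}\}<s\le v-q+\frac{u+v}{q-1}+1}\binom{u+v-(s-v+q-1)(q-1)}{(s-2v+2q)(q-1)-2(u+v)}, \] \[ \mathrm{II}=\sum_{\substack{0\le s\le 2\\ \max\{0,\,v-s+\frac{u+v}{q-1}\}<\alpha\le\min\{q-1,\,v-s+\frac{u+v}{q-1}+1\}}}\binom{u+v-(s+\alpha-v-1)(q-1)}{(s+2\alpha-2v)(q-1)-2(u+v)}, \] \[ \mathrm{III}=\sum_{\substack{-1\le s\le 1\\ \max\{s-\frac{u+v}{q-1},\,v-q+1\}\le\epsilon<\min\{s-\frac{u+v}{q-1}+1,\,v\}}}(-1)^{v+\epsilon}\binom{u+2v-(s-\epsilon)(q-1)-\epsilon}{(s-2\epsilon+1)(q-1)-2u-v-\epsilon}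 -\sum_{\max\{-2,\,v-q+\frac{u+v}{q-1}\}<s\le\min\{1,\,v-q+\frac{u+v}{q-1}+1\}}\binom{u+v-(s-v+q-1)(q-1)}{(s-2v+2q)(q-1)-2(u+v)}. \]
   Context: For an integer $n\ge 0$, the $n$th reversed Dickson polynomial $D_n(1,x)\in\mathbb Z[x]$ is defined by $D_n(1,x(1-x))=x^n+(1-x)^n$, regarded over $\mathbb F_q$ by reducing coefficients. $\delta_n=1$ if $n\equiv 0\pmod{q-1}$ and $\delta_n=0$ otherwise. For integers $m\ge 0$ and $k$, $\binom mk$ is the usual binomial coefficient, taken to be $0$ unless $0\le k\le m$. *)

(* Defs.v *)
From HB Require Import structures.
From mathcomp Require Import all_boot all_order all_algebra all_field.
From mathcomp Require Import ring.
Set Implicit Arguments. Unset Strict Implicit. Unset Printing Implicit Defensive.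
Import Order.TTheory GRing.Theory Num.Theory.
Local Open Scope ring_scope.

(* Reversed Dickson polynomials D_n(1,x) in Z[x], via the pair recursion
   D_0 = 2, D_1 = 1, D_{n+2} = D_{n+1} - x D_n. *)
Fixpoint Dpair (n : nat) : {poly int} * {poly int} :=
  match n with
  | 0%N => (2%:P, 1)
  | n'.+1 => let: (a, b) := Dpair n' in (b, b - 'X * a)
  end.
Definition rdickson (n : nat) : {poly int} := (Dpair n).1.

Lemma rdickson_def (n : nat) :
  rdickson n \Po ('X * (1 - 'X)) = 'X ^+ n + (1 - 'X) ^+ n.
Proof.
suff H : forall m, (Dpair m).1 \Po ('X * (1 - 'X)) = 'X ^+ m + (1 - 'X) ^+ m /\
  (Dpair m).2 \Po ('X * (1 - 'X)) = 'X ^+ m.+1 + (1 - 'X) ^+ m.+1.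
  by case: (H n).
elim=> [|m [IH1 IH2]] /=.
  rewrite comp_polyC comp_polyC !expr0 !expr1; split.
    by rewrite -[2 : int]/(1 + 1) polyCD polyC1.
  by rewrite polyC1 addrCA subrr addr0.
case: (Dpair m) IH1 IH2 => a b /= IH1 IH2; split=> //.
rewrite comp_polyB comp_polyM comp_polyX IH1 IH2.
set X := ('X : {poly int}).
rewrite !exprS. ring.
Qed.

Definition binz (m k : int) : int :=
  if (0 <= m) && (0 <= k) then ('C(`|m|%N, `|k|%N))%:Z else 0.

(* integer window [-q^2, q^2]; all indices satisfying the constraints below lie in it *)
Definition zwin (q : nat) : seq int :=
  [seq (i%:Z - (q ^ 2)%N%:Z) | i <- iota 0 (2 * q ^ 2).+1].

Definition ratio (q u v : nat) : rat := (u + v)%:R / (q%:R - 1).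

Definition termI (q u v : nat) : int :=
  let x := ratio q u v in
  \sum_(s <- zwin q |
        (Num.max (-1) (v%:R - q%:R + x) < s%:~R) && (s%:~R <= v%:R - q%:R + x + 1))
    binz (u%:Z + v%:Z - (s - v%:Z + q%:Z - 1) * (q%:Z - 1))
         ((s - 2 * v%:Z + 2 * q%:Z) * (q%:Z - 1) - 2 * (u%:Z + v%:Z)).

Definition termII (q u v : nat) : int :=
  let x := ratio q u v in
  \sum_(s <- zwin q | (0 <= s) && (s <= 2))
   \sum_(a <- zwin q |
        (Num.max 0 (v%:R - s%:~R + x) < a%:~R) &&
        (a%:~R <= Num.min (q%:R - 1) (v%:R - s%:~R + x + 1)))
    binz (u%:Z + v%:Z - (s + a - v%:Z - 1) * (q%:Z - 1))
         ((s + 2 * a - 2 * v%:Z) * (q%:Z - 1) - 2 * (u%:Z + v%:Z)).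

Definition termIII (q u v : nat) : int :=
  let x := ratio q u v in
  (\sum_(s <- zwin q | (-1 <= s) && (s <= 1))
   \sum_(e <- zwin q |
        (Num.max (s%:~R - x) (v%:R - q%:R + 1) <= e%:~R) &&
        (e%:~R < Num.min (s%:~R - x + 1) v%:R))
    (-1) ^+ absz (v%:Z + e) *
    binz (u%:Z + 2 * v%:Z - (s - e) * (q%:Z - 1) - e)
         ((s - 2 * e + 1) * (q%:Z - 1) - 2 * u%:Z - v%:Z - e))
  - \sum_(s <- zwin q |
        (Num.max (-2) (v%:R - q%:R + x) < s%:~R) &&
        (s%:~R <= Num.min 1 (v%:R - q%:R + x + 1)))
    binz (u%:Z + v%:Z - (s - v%:Z + q%:Z - 1) * (q%:Z - 1))
         ((s - 2 * v%:Z + 2 * q%:Z) * (q%:Z - 1) - 2 * (u%:Z + v%:Z)).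

Definition deltan (q n : nat) : nat := ((q - 1) %| n)%N.

(* Main.v *)
(* If a = x(1-x) then D_n(1,a) = x^n + (1-x)^n, so D_n(1,a)^3 is the sum of
   f(x) = x^(3n) + 3 x^(2n) (1-x)^n and f(1-x).  Since
   (X^q - X)(X^q + X - 1) is the product over a in F_q of X^2 - X + a, summing
   over a gives the sum of f over F_q plus the sum of f over the set B of roots
   of X^q + X - 1.  The degree of D_k being at most k/2, the same identity with
   f(x) = x^k shows that the first 2(q-1) power sums of B are opposite to those
   of F_q.  This evaluates the sum of x^u (1-x)^v over B, hence that of x^(3n).
   For the other one, z = (1-x)/x satisfies z = x^(q-1) and z^(q+1) = 1 on B, so
   writing n = E(q-1) + t the sum of x^(2n) (1-x)^n over B becomes that of
   x^(3t) z^(t+E).  The identity x(1+z) = 1 is a Pascal-type recursion for the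
   sums of x^rho z^j, whose solution is a combination of three binomials.
   Finally the quotients (u+v)/(q-1) in I, II, III equal E - v + t/(q-1), so
   every window contains a single integer. *)
Require Import Defs.
From HB Require Import structures.
From mathcomp Require Import all_boot all_order all_algebra all_fingroup all_solvable all_field.
From mathcomp Require Import zify ring.
Set Implicit Arguments. Unset Strict Implicit.
Import Order.TTheory GRing.Theory Num.Theory.
Local Open Scope ring_scope.

(** * Power sums over a finite field *)

Lemma card_finField_pnat (F : finFieldType) : [pchar F].-nat #|F|.
Proof.
have [p p_pr pF] := finPcharP F.
have /abelem_pgroup := fin_ring_pchar_abelem pF; rewrite /pgroup cardsT.
apply: sub_in_pnat => r _; rewrite !inE => /eqP ->.
by have := pF; rewrite inE.
Qed.

Lemma natr_card_finField (F : finFieldType) : #|F|%:R = 0 :> F.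
Proof.
have := expg_cardG (in_setT (1 : F)).
by rewrite cardsT FinRing.zmodXgE.
Qed.

Lemma expf_card_pred (F : finFieldType) (x : F) : x != 0 -> x ^+ #|F|.-1 = 1.
Proof.
move=> x0; apply: (mulfI x0); rewrite mulr1 -exprS prednK ?expf_card //.
by rewrite ltnW ?finNzRing_gt1.
Qed.

(** Substituting g * x for x multiplies the sum by g^k, so a nonzero sum forces g^k = 1 for every
    nonzero g. Then X^r - 1, with r the remainder of k modulo q - 1, has q - 1 roots, which is too
    many unless r = 0. Since x^0 = 1 also at x = 0, the exponent k = 0 gives q = 0, hence the
    condition [0 < k]. *)
Lemma sum_expf (F : finFieldType) (k : nat) :
  \sum_(x : F) x ^+ k = - ((0 < k) && (#|F|.-1 %| k))%N%:R.
Proof.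
have q_gt1 := finNzRing_gt1 F.
have [->|k_gt0] /= := posnP k.
  under eq_bigr do rewrite expr0.
  by rewrite sumr_const natr_card_finField oppr0.
have xq1 := @expf_card_pred F.
have [dvd|ndvd] := boolP (#|F|.-1 %| k)%N.
  rewrite (bigD1 0) //= expr0n gtn_eqF // add0r.
  rewrite (eq_bigr (fun=> 1)) => [|x x0].
    rewrite sumr_const cardC1; apply: (addIr 1).
    by rewrite -mulrSr prednK ?natr_card_finField ?addNr // ltnW.
  by case/dvdnP: dvd => c ->; rewrite mulnC exprM xq1 // expr1n.
rewrite oppr0; apply/eqP/negPn/negP => S0; case/negP: ndvd.
have all1 (g : F) : g != 0 -> g ^+ k = 1.
  move=> g0; apply: (mulIf S0); rewrite mul1r mulr_sumr.
  rewrite [RHS](reindex_inj (mulfI g0)) /=.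
  by apply: eq_bigr => x _; rewrite exprMn.
rewrite /dvdn; set r := (k %% _)%N; apply/negPn/negP => r0.
have rq : (r < #|F|.-1)%N by rewrite ltn_mod -subn1 subn_gt0.
have allr (g : F) : g != 0 -> g ^+ r = 1.
  move=> g0; rewrite -(all1 g g0) [in RHS](divn_eq k #|F|.-1) exprD mulnC.
  by rewrite exprM xq1 // expr1n mul1r.
have p0 : 'X^r - 1%:P != 0 :> {poly F}.
  by rewrite -size_poly_gt0 size_XnsubC ?lt0n.
have := max_poly_roots (rs := enum (predC1 (0 : F))) p0.
rewrite size_XnsubC ?lt0n // -cardE cardC1 enum_uniq ltnS leqNgt rq.
suff -> : all (root ('X^r - 1%:P)) (enum (predC1 (0 : F))).
  by move=> /(_ isT isT) /negP; apply.
apply/allP => g; rewrite mem_enum !inE => g0.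
by rewrite rootE !hornerE allr // subrr.
Qed.

(** * Reversed Dickson polynomials: evaluation and degree *)

Lemma map_rdickson_horner (R : comNzRingType) (n : nat) (x : R) :
  (map_poly intr (rdickson n)).[x * (1 - x)] = x ^+ n + (1 - x) ^+ n.
Proof.
have := congr1 (fun p => (map_poly (intr : int -> R) p).[x]) (rdickson_def n).
rewrite map_comp_poly horner_comp.
rewrite !(rmorphM, rmorphB, rmorphD, rmorphXn, rmorph1, hornerE) /=.
by rewrite !(map_polyX, hornerE).
Qed.

Lemma size_rdickson (n : nat) : (size (rdickson n) <= n./2.+1)%N.
Proof.
suff: (size (Dpair n).1 <= n./2.+1)%N && (size (Dpair n).2 <= n.+1./2.+1)%N.
  by case/andP.
elim: n => [|n] /=; first by rewrite size_polyC size_polyC.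
case: (Dpair n) => a b /= /andP[Ha Hb]; rewrite Hb /=.
apply: leq_trans (size_polyD _ _) _; rewrite geq_max size_polyN.
apply/andP; split; first by apply: leq_trans Hb _; rewrite uphalf_half; lia.
by apply: leq_trans (size_polyMleq _ _) _; rewrite size_polyX /=.
Qed.

(** The degree is at most k/2 < q - 1, and every power sum of exponent below q - 1 vanishes. *)
Lemma sum_rdickson_small (F : finFieldType) (k : nat) :
  (k < 2 * #|F|.-1)%N ->
  \sum_(a : F) (map_poly intr (rdickson k) : {poly F}).[a] = 0.
Proof.
move=> k_lt; set p := map_poly _ _.
have sz : (size p <= #|F|.-1)%N.
  apply: leq_trans (size_poly _ _) (leq_trans (size_rdickson k) _).
  by have := odd_double_half k; lia.
under eq_bigr do rewrite (horner_coef_wide _ sz).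
rewrite exchange_big big1 //= => i _; rewrite -mulr_sumr sum_expf.
case: posnP => [|i0] /=; first by rewrite oppr0 mulr0.
by rewrite gtnNdvd // oppr0 mulr0.
Qed.

(** * Binomial coefficients in characteristic p *)

Lemma coef_exp1X (R : comNzRingType) n k :
  ((1 + 'X) ^+ n : {poly R})`_k = 'C(n, k)%:R.
Proof.
elim: n k => [|n IH] [|k]; rewrite ?expr0 ?coef1 ?bin0 ?bin0n //.
  by rewrite exprS mulrDl mul1r coefD coefXM IH bin0 addr0.
by rewrite exprS mulrDl mul1r coefD coefXM !IH binS natrD.
Qed.

Section BinomialModP.

Variables (R : comNzRingType) (q : nat).
Hypothesis q_pnat : [pchar R].-nat q.

(** Coefficient of X^k in (1+X)^(q+m) = (1+X^q)(1+X)^m. *)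
Lemma bin_frobenius m k :
  'C(q + m, k)%:R = 'C(m, k)%:R + (if (q <= k)%N then 'C(m, k - q)%:R else 0) :> R.
Proof.
rewrite -!coef_exp1X exprD exprDn_pchar; last by rewrite (eq_pnat _ (pchar_poly R)).
by rewrite expr1n mulrDl mul1r coefD coefXnM ltnNge; case: leqP.
Qed.

(** This is upper negation: modulo p the top entry is r - v - 1. Induction on v uses Pascal's rule;
    the bound on r keeps the Frobenius term out of the base case. *)
Lemma bin_flip v r : (v < q)%N -> (r < q)%N ->
  'C(q.-1 - v + r, r)%:R = (-1) ^+ r * 'C(v, r)%:R :> R.
Proof.
elim: v r => [|v IH] r vq rq.
  case: r rq => [|r] rq; first by rewrite !bin0 mulr1.
  rewrite subn0 addnS -addSn prednK // bin_frobenius.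
  by rewrite bin_small // bin0n mulr0 add0r leqNgt rq.
case: r rq => [|r] rq; first by rewrite !bin0 mulr1.
have := IH r.+1 (ltnW vq) rq.
rewrite addnS binS natrD IH ?(ltnW vq) ?(ltnW rq) //.
move/(canRL (addrK _)) => H.
rewrite (_ : q.-1 - v.+1 + r.+1 = q.-1 - v + r)%N; last by lia.
by rewrite H binS natrD exprS; ring.
Qed.

(** Only w = q - 1 gives a nonzero value: for q <= w < 2(q-1) the binomial drops to C(w-q, q-1) = 0.
    Hence the term of the theorem with a power of 1/2 is just a divisibility indicator. *)
Lemma half_exp_bin w : (0 < w < 2 * q.-1)%N -> (2%:R : R) ^+ q.-1 = 1 ->
  'C(w, q.-1)%:R = (q.-1 %| w)%N%:R * 2%:R ^+ w :> R.
Proof.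
case/andP=> w_gt0 w_lt two.
have [lt|gt|->] := ltngtP w q.-1.
- by rewrite bin_small // gtnNdvd // mul0r.
- rewrite (_ : (w = q + (w - q))%N); last by lia.
  rewrite bin_frobenius bin_small; last by lia.
  rewrite ifN; last by lia.
  rewrite addr0 (_ : (q + (w - q))%N = w); last by lia.
  rewrite (_ : (_ %| _)%N = false) ?mul0r //.
  by apply/negP => /dvdnP[[|[|c]] E]; nia.
by rewrite binn dvdnn two mulr1.
Qed.

End BinomialModP.

(* The coefficient of X^r in X^(i(q-1)) (1+X)^n. *)
Definition shiftbin (q n r i : nat) : nat :=
  if (i * q.-1 <= r)%N then 'C(n, r - i * q.-1) else 0%N.

(** The binomials of I, II, III are read from the other end, through C(m, k) = C(m, m-k). When the
    lower entry leaves [0, m], both sides are zero. *)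
Lemma binz_shiftbin q m r i (T B : int) :
  T = m%:Z -> B = m%:Z - r%:Z + (i * q.-1)%N%:Z -> binz T B = (shiftbin q m r i)%:Z.
Proof.
move=> -> -> {T B}; rewrite /binz /shiftbin lez_nat leq0n /=.
case E: (_ - _ + _) => [d|d] /=; case: leqP => [le|lt].
- have [dm|dm] := leqP d m; last by rewrite !bin_small //; lia.
  by rewrite -(bin_sub dm); congr ('C(_, _)%:Z); lia.
- by rewrite bin_small //; lia.
- by rewrite bin_small //; lia.
- by [].
Qed.

(** After reducing exponents modulo q - 1 and expanding (1-x)^t, only the powers 3t - j divisible by
    q - 1 survive; as 3t < 3(q-1), these are 0, q - 1 or 2(q-1) at most. *)
Lemma sum_expf_bimonomial (F : finFieldType) (n : nat) :
  (0 < n)%N -> odd #|F| ->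
  \sum_(x : F) x ^+ (2 * n) * (1 - x) ^+ n =
  - (#|F|.-1 %| n)%:R - \sum_(i < 3) (shiftbin #|F| (n %% #|F|.-1) (3 * (n %% #|F|.-1)) i)%:R.
Proof.
move=> n_gt0 q_odd; set q := #|F|; set t := (n %% q.-1)%N.
have q_gt1 : (1 < q)%N := finNzRing_gt1 F.
have q1_gt0 : (0 < q.-1)%N by lia.
have t_lt : (t < q.-1)%N by rewrite ltn_mod.
have xq1 (x : F) : x != 0 -> x ^+ q.-1 = 1 := @expf_card_pred F x.
(* For t = 0 each x other than 0 and 1 contributes 1, so the sum is q - 2 = -2: one -1 from the
   divisibility indicator and one from i = 0. *)
have [t0|t_gt0] := posnP t.
  have sb i : shiftbin q 0 0 i = (i == 0%N).
    by rewrite /shiftbin leqn0 muln_eq0 (gtn_eqF q1_gt0) orbF; case: i.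
  rewrite t0 muln0 !big_ord_recl big_ord0 !sb /= !addr0.
  have dvd : (q.-1 %| n)%N by rewrite /dvdn -/t t0.
  have E (x : F) : x != 0 -> x ^+ n = 1.
    by move=> x0; case/dvdnP: dvd => c ->; rewrite mulnC exprM xq1 // expr1n.
  rewrite dvd (bigD1 0) //= (bigD1 1) ?oner_eq0 //= subrr !expr0n.
  rewrite muln_eq0 [(2 == 0)%N]/= (gtn_eqF n_gt0) mul0r mulr0 !add0r.
  rewrite (eq_bigr (fun=> 1)) => [|x /andP[x0 x1]].
    have := natr_card_finField F; rewrite -sum1_card natr_sum.
    rewrite (bigD1 0) //= (bigD1 1) ?oner_eq0 //= => /eqP.
    by rewrite addrA addrC addr_eq0 opprD => /eqP.
  by rewrite mulnC exprM E // expr1n mul1r E // subr_eq0 eq_sym.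
have ndvd : (q.-1 %| n)%N = false by rewrite /dvdn -/t gtn_eqF.
rewrite ndvd oppr0 sub0r.
(* Positivity of k, n and t is what makes the reduction valid at x = 0. *)
have redx (x : F) k : (0 < k)%N -> x ^+ (k * n) = x ^+ (k * t).
  move=> k_gt0; have [->|x0] := eqVneq x 0.
    by rewrite !expr0n !muln_eq0 !gtn_eqF.
  by rewrite ![(k * _)%N]mulnC !exprM -(expr_mod n (xq1 x x0)).
transitivity (\sum_(x : F) \sum_(j < t.+1)
    (-1) ^+ (t - j) * 'C(t, j)%:R * x ^+ (3 * t - j)).
  apply: eq_bigr => x _; rewrite redx // -[in (1 - x) ^+ n](mul1n n) redx // mul1n.
  rewrite addrC exprDn mulr_sumr; apply: eq_bigr => j _.
  rewrite expr1n mulr1 [(- x) ^+ _]exprNn -mulr_natr.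
  rewrite (_ : (3 * t - j = 2 * t + (t - j))%N); last by have := ltn_ord j; lia.
  by rewrite exprD; ring.
rewrite exchange_big /=; under eq_bigr do rewrite -mulr_sumr sum_expf.
transitivity (- \sum_(i < 3) \sum_(j < t.+1) ((3 * t - j)%N == (i * q.-1)%N)%:R * 'C(t, j)%:R : F).
  rewrite exchange_big -sumrN; apply: eq_bigr => j _ /=.
  have j_le := ltn_ord j; rewrite -mulr_suml mulrN; congr (- _).
  rewrite -/q subn_gt0 (_ : (j < 3 * t)%N); last by lia.
  rewrite !big_ord_recl big_ord0 /= /bump /= addr0.
  case: dvdnP => [[c E]|nE] /=; last first.
    rewrite mulr0; rewrite !(introF eqP) ?mulr0n ?addr0 ?mul0r //.
    - by move=> E; apply: nE; exists 2%N.
    - by move=> E; apply: nE; exists 1%N.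
    - by move=> E; apply: nE; exists 0%N.
  have c_lt : (c < 3)%N by nia.
  (* The number q - 1 is even, so 3t - j = c(q-1) is even, and t - j has the same parity. *)
  have sg : (-1) ^+ (t - j) = 1 :> F.
    have : odd (3 * t - j) = false by rewrite E oddM -subn1 oddB ?q_odd ?andbF // ltnW.
    rewrite -signr_odd => od; rewrite (_ : odd (t - j) = false) //.
    by rewrite oddB //; move: od; rewrite oddB ?oddM //; lia.
  rewrite sg mul1r mulr1 E !eqn_pmul2r //.
  by case: c c_lt {E} => [|[|[|c]]] //= _; rewrite ?addr0 ?add0r mul1r.
congr (- _); apply: eq_bigr => i _; rewrite /shiftbin.
case: leqP => [le|lt]; last first.
  by rewrite big1 // => j _; rewrite (introF eqP) ?mul0r //; have := ltn_ord j; lia.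
have [jt|jt] := leqP (3 * t - i * q.-1) t; last first.
  rewrite bin_small // big1 // => j _.
  by rewrite (introF eqP) ?mul0r //; have := ltn_ord j; lia.
rewrite (bigD1 (Ordinal (jt : 3 * t - i * q.-1 < t.+1)%N)) //= subKn // eqxx mul1r.
rewrite big1 ?addr0 // => j; rewrite -val_eqE /= => /eqP ne.
by rewrite (introF eqP) ?mul0r //; have := ltn_ord j; lia.
Qed.

(** * The roots of X^q + X - 1 and their power sums *)

Section TraceOne.

Variables (F : finFieldType) (K : closedFieldType) (iota : {rmorphism F -> K}).
Local Notation q := #|F|.

Lemma pnat_card_ext : [pchar K].-nat q.
Proof.
rewrite (eq_pnat (rho := [pchar F])) ?card_finField_pnat // => p.
exact: fmorph_pchar.
Qed.

Lemma natr_card_ext : q%:R = 0 :> K.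
Proof. by rewrite -(rmorph_nat iota) natr_card_finField rmorph0. Qed.

Lemma dickson_root : exists r : F -> K, forall a, r a * (1 - r a) = iota a.
Proof.
suff /fin_all_exists : forall a : F, exists x, x * (1 - x) = iota a by [].
move=> a; have sz : size ('X^2 - 'X + (iota a)%:P : {poly K}) == 1%N = false.
  by rewrite -addrA size_polyDl size_polyXn // (leq_ltn_trans (size_polyD _ _)) //
    size_polyN size_polyX size_polyC; case: (_ != 0).
have /closed_rootP [x] := negbT sz.
rewrite rootE !hornerE => /eqP H; exists x.
by apply/eqP; rewrite -subr_eq0 -oppr_eq0 -H; apply/eqP; ring.
Qed.

Hypothesis q_odd : odd q.
Variable rs : seq K.
Hypothesis rsE : 'X^q + 'X - 1 = \prod_(x <- rs) ('X - x%:P) :> {poly K}.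

Lemma trace_one x : x \in rs -> x ^+ q = 1 - x.
Proof.
rewrite -root_prod_XsubC -rsE rootE !hornerE => /eqP H.
by apply/eqP; rewrite -subr_eq0 -H; apply/eqP; ring.
Qed.

Lemma trace_one_neq0 x : x \in rs -> x != 0.
Proof.
move=> xrs; apply/eqP => x0; have := trace_one xrs.
rewrite x0 expr0n gtn_eqF ?(ltnW (finNzRing_gt1 F)) // subr0 => /esym/eqP.
by rewrite oner_eq0.
Qed.

Lemma trace_one_compl x : x \in rs -> (1 - x) ^+ q = x.
Proof.
move=> xrs; rewrite exprDn_pchar ?pnat_card_ext // exprNn_pchar ?pnat_card_ext //.
by rewrite expr1n trace_one // subKr.
Qed.

(** The multiset of all [r a] and [1 - r a] equals F together with [rs], because the monic
    polynomials with these roots agree. *)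
Lemma sum_dickson_roots (r : F -> K) (f : K -> K) :
    (forall a, r a * (1 - r a) = iota a) ->
  \sum_a (f (r a) + f (1 - r a)) = \sum_a f (iota a) + \sum_(x <- rs) f x.
Proof.
move=> rE; pose s := flatten [seq [:: r a; 1 - r a] | a <- index_enum F].
have -> : \sum_a (f (r a) + f (1 - r a)) = \sum_(x <- s) f x.
  rewrite big_flatten big_map; apply: eq_bigr => a _.
  by rewrite big_cons big_seq1.
rewrite -(big_map iota xpredT f) -big_cat; apply: perm_big.
apply: prod_XsubC_eq; rewrite big_cat big_map -rsE big_flatten big_map /=.
pose Y : {poly K} := 'X * (1 - 'X).
have genK : 'X^q - 'X = \prod_a ('X - (iota a)%:P) :> {poly K}.
  have := congr1 (map_poly iota) (finField_genPoly F).
  rewrite rmorphB rmorphXn /= map_polyX rmorph_prod => ->.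
  by apply: eq_bigr => a _; rewrite rmorphB /= map_polyX map_polyC.
have -> : \prod_a ('X - (iota a)%:P) = 'X^q - 'X :> {poly K} by rewrite genK.
transitivity (\prod_a ((iota a)%:P - Y)).
  apply: eq_bigr => a _; rewrite big_cons big_seq1 -rE /Y.
  by rewrite polyCM polyCB polyC1 /=; ring.
(* Substituting Y in X^q - X gives the product of the Y - a; turning each factor into a - Y costs
   (-1)^q = -1. *)
transitivity (- (Y ^+ q - Y)).
  have := congr1 (comp_poly Y) genK.
  rewrite rmorphB rmorphXn rmorph_prod /= comp_polyX => ->.
  under eq_bigr do rewrite -opprB.
  rewrite prodrN cardT -cardE -signr_odd q_odd expr1 mulN1r; congr (- _).
  by apply: eq_bigr => a _; rewrite rmorphB /= comp_polyX comp_polyC.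
rewrite /Y exprMn exprDn_pchar; last first.
  by rewrite (eq_pnat _ (pchar_poly K)) pnat_card_ext.
rewrite exprNn_pchar; last by rewrite (eq_pnat _ (pchar_poly K)) pnat_card_ext.
by rewrite expr1n; ring.
Qed.

Lemma rmorph_rdickson k (a : F) (x : K) : x * (1 - x) = iota a ->
  iota (map_poly intr (rdickson k) : {poly F}).[a] = x ^+ k + (1 - x) ^+ k.
Proof.
move=> xE; rewrite -map_rdickson_horner xE -horner_map -map_poly_comp.
by congr (_.[_]); apply: eq_map_poly => m /=; rewrite rmorph_int.
Qed.

Lemma power_sum_trace_one k : (k < 2 * q.-1)%N ->
  \sum_(x <- rs) x ^+ k = ((0 < k) && (q.-1 %| k))%N%:R.
Proof.
move=> kq; have [r rE] := dickson_root.
have := sum_dickson_roots (fun x => x ^+ k) rE.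
under [in RHS]eq_bigr do rewrite -rmorphXn.
rewrite -rmorph_sum sum_expf rmorphN rmorph_nat /=.
under eq_bigr do rewrite -(rmorph_rdickson k (rE _)).
rewrite -rmorph_sum sum_rdickson_small // rmorph0 => /esym/eqP.
by rewrite addrC subr_eq0 => /eqP.
Qed.

(** Expanding (1-x)^v leaves only the power x^(q-1): the other multiple of q - 1 in range is 0,
    whose power sum is q = 0. *)
Lemma bimonomial_sum_trace_one u v : (u <= q.-1)%N -> (u + v < 2 * q.-1)%N ->
  \sum_(x <- rs) x ^+ u * (1 - x) ^+ v = (-1) ^+ u * 'C(v, q.-1 - u)%:R.
Proof.
move=> uq uvq.
transitivity (\sum_(i < v.+1) (-1) ^+ i * 'C(v, i)%:R *
    \sum_(x <- rs) x ^+ (u + i) : K).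
  under [RHS]eq_bigr do rewrite mulr_sumr.
  rewrite exchange_big; apply: eq_bigr => x _ /=.
  rewrite exprDn mulr_sumr; apply: eq_bigr => i _.
  by rewrite expr1n mul1r [(- x) ^+ i]exprNn exprD -mulr_natr; ring.
have q_gt1 : (1 < q)%N := finNzRing_gt1 F.
have pE i : (i < v.+1)%N ->
    \sum_(x <- rs) x ^+ (u + i) = (i == (q.-1 - u)%N)%:R :> K.
  move=> iv; rewrite power_sum_trace_one; last by lia.
  congr (_%:R); congr nat_of_bool; apply/andP/eqP => [[ui /dvdnP[c E]]|->].
    by case: c E => [|[|c]] E; nia.
  by rewrite subnKC // dvdnn; split; lia.
have sgE : (-1) ^+ (q.-1 - u) = (-1) ^+ u :> K.
  rewrite -signr_odd -[RHS]signr_odd; congr (_ ^+ nat_of_bool _).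
  by move: q_odd; lia.
under eq_bigr do rewrite pE //.
have [le|lt] := leqP (q.-1 - u) v; last first.
  rewrite bin_small // mulr0 big1 // => i _.
  by rewrite ltn_eqF ?mulr0 // (leq_trans _ lt).
rewrite (bigD1 (Ordinal (le : q.-1 - u < v.+1)%N)) //= eqxx mulr1 sgE.
rewrite big1 ?addr0 // => i; rewrite -val_eqE /= => /negPf ->.
by rewrite mulr0.
Qed.

Definition slope (x : K) : K := (1 - x) / x.
Local Notation z := slope.

Lemma trace_one_slope_neq0 x : x \in rs -> z x != 0.
Proof.
move=> xrs; apply: mulf_neq0; last by rewrite invr_eq0 trace_one_neq0.
by rewrite -(trace_one xrs) expf_neq0 // trace_one_neq0.
Qed.

Lemma trace_one_slopeX x : x \in rs -> z x ^+ q = (z x)^-1.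
Proof.
by move=> xrs; rewrite /slope expr_div_n trace_one_compl // trace_one // invf_div.
Qed.

Lemma trace_one_slopeS x : x \in rs -> z x ^+ q.+1 = 1.
Proof.
move=> xrs; rewrite exprSr trace_one_slopeX // mulVf //.
exact: trace_one_slope_neq0.
Qed.

(** The sign and the shift to [M.+1] are chosen so that x(1+z) = 1 becomes Pascal's rule without
    signs, and so that the values at rho = 0, M < q are all 1. *)
Definition slope_sum (rho M : nat) : K :=
  (-1) ^+ (rho + M) * \sum_(x <- rs) x ^+ rho * z x ^+ M.+1.

(* X (1 + U) = (1+X)^(q+1) - 1 in characteristic p, and W truncates the inverse
   of 1 + U.  So slope_coef is a residue at 0, and by the residue theorem it
   should be a sum over the other (q+1)-st roots of unity, namely slope_sum. *)
Definition slope_U : {poly K} := 'X^(q.-1) * (1 + 'X).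
Definition slope_W : {poly K} := 1 - slope_U + slope_U ^+ 2.
Definition slope_coef (rho M : nat) : K := ((1 + 'X) ^+ M * slope_W)`_rho.

Lemma slope_sum_rec rho M :
  slope_sum rho.+1 M.+1 - slope_sum rho.+1 M = slope_sum rho M.
Proof.
rewrite /slope_sum.
have -> : (-1) ^+ (rho.+1 + M.+1) = (-1) ^+ (rho + M) :> K.
  by rewrite addSn addnS !exprS; ring.
have -> : (-1) ^+ (rho.+1 + M) = - (-1) ^+ (rho + M) :> K.
  by rewrite addSn exprS mulN1r.
rewrite mulNr opprK -mulrDr.
congr (_ * _); rewrite -big_split /=; apply: eq_big_seq => x xrs.
by rewrite /slope !exprS; field; exact: trace_one_neq0.
Qed.

Lemma slope_coef_rec rho M :
  slope_coef rho.+1 M.+1 - slope_coef rho.+1 M = slope_coef rho M.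
Proof.
rewrite /slope_coef exprS -mulrA mulrDl mul1r coefD coefXM /=.
by rewrite addrC addKr.
Qed.

Lemma slope_sum0 M : (M < q)%N -> slope_sum 0 M = 1.
Proof.
move=> Mq; rewrite /slope_sum add0n.
(* One factor 1 - x is replaced by x^q, which absorbs the denominator x^(M+1) because M < q. *)
transitivity ((-1) ^+ M * \sum_(x <- rs) x ^+ (q - M.+1) * (1 - x) ^+ M).
  congr (_ * _); apply: eq_big_seq => x xrs.
  have x0 := trace_one_neq0 xrs.
  rewrite expr0 mul1r /slope expr_div_n exprS -(trace_one xrs).
  by rewrite -[in X in X * _ / _](subnK Mq) exprD mulrAC mulfK // expf_neq0.
have q_gt1 : (1 < q)%N := finNzRing_gt1 F.
rewrite bimonomial_sum_trace_one; try lia.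
rewrite (_ : (q.-1 - (q - M.+1))%N = M); last by lia.
rewrite binn mulr1 -exprD -signr_odd (_ : (M + (q - M.+1))%N = q.-1); last by lia.
by rewrite -subn1 oddB ?q_odd // ltnW.
Qed.

Lemma slope_coef0 M : slope_coef 0 M = 1.
Proof.
have q_gt1 : (1 < q)%N := finNzRing_gt1 F.
rewrite /slope_coef -horner_coef0 /slope_W /slope_U !hornerE.
have -> : 0 ^+ q.-1 = 0 :> K by rewrite expr0n gtn_eqF // -subn1 subn_gt0.
by rewrite expr1n mul1r subr0 expr0n addr0.
Qed.

(** A geometric sum in -z over a full period: q + 1 is even, so (-z)^(q+1) = 1, while -z - 1 = -1/x
    is nonzero. *)
Lemma slope_sum_period rho : \sum_(M < q.+1) slope_sum rho M = 0.
Proof.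
rewrite /slope_sum.
transitivity ((-1) ^+ rho * \sum_(x <- rs) x ^+ rho * z x *
    \sum_(M < q.+1) (- z x) ^+ M).
  rewrite mulr_sumr; under [RHS]eq_bigr do rewrite !mulr_sumr.
  rewrite exchange_big; apply: eq_bigr => M _ /=.
  rewrite mulr_sumr; apply: eq_bigr => x _.
  by rewrite exprD [(- z x) ^+ M]exprNn [z x ^+ M.+1]exprS; ring.
rewrite big1_seq ?mulr0 // => x /andP[_ xrs].
have x0 := trace_one_neq0 xrs.
have z1 : - z x - 1 != 0.
  suff -> : - z x - 1 = - x^-1 by rewrite oppr_eq0 invr_eq0.
  by rewrite /slope; field.
apply/eqP; rewrite mulf_eq0; apply/orP; right.
rewrite -(mulrI_eq0 _ (mulfI z1)) -subrX1 exprNn trace_one_slopeS //.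
rewrite -signr_odd (_ : odd q.+1 = false) ?mulr1 ?subrr //=.
by rewrite q_odd.
Qed.

(** The geometric sum of the (1+X)^M is 1 + U, and (1+U)W = 1 + U^3 has no term of degree strictly
    between 0 and 3(q-1). *)
Lemma slope_coef_period rho : (0 < rho < 3 * q.-1)%N ->
  \sum_(M < q.+1) slope_coef rho M = 0.
Proof.
case/andP=> rho_gt0 rho_lt; rewrite /slope_coef -coef_sum -mulr_suml.
have q_gt1 : (1 < q)%N := finNzRing_gt1 F.
have -> : \sum_(M < q.+1) (1 + 'X) ^+ M = 1 + slope_U.
  apply: (mulfI (negbT (polyX_eq0 K))).
  have := subrX1 (1 + 'X : {poly K}) q.+1.
  rewrite [1 + 'X - 1]addrC addKr => <-.
  rewrite exprSr exprDn_pchar; last first.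
    by rewrite (eq_pnat _ (pchar_poly K)) pnat_card_ext.
  rewrite expr1n /slope_U -(prednK (ltnW q_gt1)) exprS /=.
  by ring.
have -> : (1 + slope_U) * slope_W = 1 + 'X^(3 * q.-1) * (1 + 'X) ^+ 3.
  rewrite mulnC exprM -exprMn -/slope_U /slope_W.
  by ring.
by rewrite coefD coefXnM rho_lt coef1 gtn_eqF // addr0.
Qed.

(* Both sides obey the same recursion, so for fixed rho > 0 their difference is
   constant in M; it vanishes because its sum over the q + 1 = 1 values M <= q
   does. *)
Lemma slope_sumE rho M : (rho < 3 * q.-1)%N -> (M < q + rho)%N ->
  slope_sum rho M = slope_coef rho M.
Proof.
elim: rho M => [|rho IH] M; first by rewrite addn0 slope_coef0 => _ /slope_sum0.
move=> rho_lt M_lt; pose D r m := slope_sum r m - slope_coef r m.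
have D_rec r m : D r.+1 m.+1 - D r.+1 m = D r m.
  by rewrite /D -(slope_sum_rec r m) -(slope_coef_rec r m); ring.
(* Each increase of rho allows one more value of M, which accounts for the bound q + rho. *)
have D_const m : (m <= q + rho)%N -> D rho.+1 m = D rho.+1 0%N.
  elim: m => // m IHm m_lt; rewrite -IHm 1?ltnW //.
  by apply/eqP; rewrite -subr_eq0 D_rec /D IH ?subrr // ltnW.
have D0 : D rho.+1 0%N = 0.
  have : \sum_(m < q.+1) D rho.+1 m = 0.
    by rewrite sumrB slope_sum_period slope_coef_period ?subrr.
  under eq_bigr => m _ do rewrite D_const ?(leq_trans (ltn_ord m : _ <= q)%N) ?leq_addr //.
  by rewrite sumr_const card_ord mulrSr -mulr_natr natr_card_ext mulr0 add0r.
apply/eqP; rewrite -subr_eq0 -/(D _ _) D_const ?D0 //.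
by move: M_lt; rewrite addnS ltnS.
Qed.

End TraceOne.

(** * Closed forms for the two sums over [rs] *)

Section TraceOneSums.

Variables (F : finFieldType) (K : closedFieldType) (iota : {rmorphism F -> K}).
Local Notation q := #|F|.
Hypothesis q_odd : odd q.
Variable rs : seq K.
Hypothesis rsE : 'X^q + 'X - 1 = \prod_(x <- rs) ('X - x%:P) :> {poly K}.

(** W = 1 - U + U^2, and U^i (1+X)^M = X^(i(q-1)) (1+X)^(M+i). *)
Lemma slope_coefE rho M :
  slope_coef F K rho M = \sum_(i < 3) (-1) ^+ i * (shiftbin q (M + i) rho i)%:R.
Proof.
have WE : slope_W F K = \sum_(i < 3) (- slope_U F K) ^+ i.
  by rewrite !big_ord_recl big_ord0 /= /slope_W; ring.
rewrite /slope_coef WE mulr_sumr coef_sum; apply: eq_bigr => i _.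
rewrite [(- slope_U F K) ^+ i]exprNn /slope_U exprMn -exprM mulrCA -signr_odd.
rewrite -[(-1) ^+ i : K]signr_odd.
rewrite (_ : (1 + 'X) ^+ M * _ = 'X^(i * q.-1) * (1 + 'X) ^+ (M + i)); last first.
  by rewrite exprD mulnC; ring.
have -> (b : bool) (p : {poly K}) : ((-1) ^+ b * p)`_rho = (-1) ^+ b * p`_rho.
  by case: b; rewrite ?mulN1r ?coefN // !mul1r.
rewrite coefXnM coef_exp1X /shiftbin; congr (_ * _).
by rewrite ltnNge; case: leqP.
Qed.

Lemma trace_one_exprB1 x : x \in rs -> x ^+ q.-1 = slope x.
Proof.
move=> xrs; have x0 := trace_one_neq0 rsE xrs.
apply: (mulfI x0); rewrite -exprS prednK; last by rewrite ltnW ?finNzRing_gt1.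
by rewrite (trace_one rsE xrs) /slope mulrC divfK.
Qed.

(** On [rs], x^(q^2-1) = z^(q+1) = 1. This allows 3n to be replaced by u' + v'q. *)
Lemma trace_one_expr_mod x k l : x \in rs -> k = l %[mod q ^ 2 - 1] ->
  x ^+ k = x ^+ l.
Proof.
move=> xrs kl; have x1 : x ^+ (q ^ 2 - 1) = 1.
  rewrite (_ : (q ^ 2 - 1 = q.-1 * q.+1)%N); last first.
    by have : (1 < q)%N := finNzRing_gt1 F; nia.
  by rewrite exprM trace_one_exprB1 // (trace_one_slopeS iota rsE xrs).
by rewrite -(expr_mod k x1) kl expr_mod.
Qed.

(** Since x^(vq) = (1-x)^v, this is a bimonomial sum, and [bin_flip] removes its sign. *)
Lemma trace_one_sum_digits u v : (u <= q.-1)%N -> (v <= q.-1)%N ->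
  \sum_(x <- rs) x ^+ (u + v * q) =
  if (u + v * q <= q ^ 2 - 2)%N then 'C(2 * q.-1 - u - v, q.-1 - u)%:R else 0.
Proof.
move=> uq vq; have q_gt1 : (1 < q)%N := finNzRing_gt1 F.
have -> : \sum_(x <- rs) x ^+ (u + v * q) = \sum_(x <- rs) x ^+ u * (1 - x) ^+ v.
  apply: eq_big_seq => x xrs.
  by rewrite exprD mulnC exprM (trace_one rsE xrs).
case: ifPn => [le|gt]; last first.
  (* In the exceptional case every summand is 1, because raising x(1-x) to the power q swaps its
     factors; the sum is then q = 0. *)
  have [-> ->] : u = q.-1 /\ v = q.-1 by nia.
  rewrite (eq_big_seq (fun x => x ^+ 0)) => [|x xrs].
    by rewrite (power_sum_trace_one iota q_odd rsE) //; lia.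
  have x0 := trace_one_neq0 rsE xrs.
  have y0 : 1 - x != 0 by rewrite -(trace_one rsE xrs) expf_neq0.
  apply: (mulfI (mulf_neq0 x0 y0)); rewrite expr0 mulr1 mulrACA -!exprS.
  rewrite prednK 1?ltnW // (trace_one rsE xrs) (trace_one_compl iota rsE xrs).
  exact: mulrC.
rewrite (bimonomial_sum_trace_one iota q_odd rsE) //; last by nia.
rewrite (_ : 2 * q.-1 - u - v = q.-1 - v + (q.-1 - u))%N; last by lia.
rewrite (bin_flip (pnat_card_ext iota)); try lia.
congr (_ * _); rewrite -signr_odd -[RHS]signr_odd; congr (_ ^+ nat_of_bool _).
by move: q_odd; lia.
Qed.

Lemma trace_one_sum_bimonomial n : (0 < n <= q ^ 2 - 2)%N ->
  let t := (n %% q.-1)%N in let E := (n %/ q.-1)%N in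
  \sum_(x <- rs) x ^+ (2 * n) * (1 - x) ^+ n =
  \sum_(i < 3) (-1) ^+ (E + 1 + i) * (shiftbin q ((t + E).-1 + i) (3 * t) i)%:R.
Proof.
case/andP=> n_gt0 n_le t E; have q_gt1 : (1 < q)%N := finNzRing_gt1 F.
have nE : n = (E * q.-1 + t)%N by exact: divn_eq.
have t_lt : (t < q.-1)%N by rewrite ltn_mod; lia.
have E_le : (E <= q)%N by nia.
have tE_gt0 : (0 < t + E)%N by nia.
transitivity ((-1) ^+ (E + 1) * slope_sum rs (3 * t) (t + E).-1).
  rewrite /slope_sum prednK // mulrA -exprD -signr_odd.
  rewrite (_ : odd _ = false) ?mul1r; last by lia.
  apply: eq_big_seq => x xrs; have x0 := trace_one_neq0 rsE xrs.
  have xn : x ^+ n = x ^+ t * slope x ^+ E.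
    by rewrite nE exprD mulnC exprM trace_one_exprB1 // mulrC.
  have -> : 1 - x = x * slope x by rewrite /slope mulrC divfK.
  rewrite exprMn mulrA -exprD (_ : 2 * n + n = n * 3)%N; last by lia.
  rewrite exprM xn exprMn -!exprM mulnC -mulrA -exprD; congr (_ * _).
  (* The exponent of z is 3E + n = (q+1)E + (t+E), and z^(q+1) = 1. *)
  rewrite (_ : E * 3 + n = q.+1 * E + (t + E))%N; last by nia.
  by rewrite exprD exprM (trace_one_slopeS iota rsE xrs) expr1n mul1r.
rewrite (slope_sumE iota q_odd rsE); try lia.
rewrite slope_coefE mulr_sumr; apply: eq_bigr => i _.
by rewrite mulrA -exprD.
Qed.

End TraceOneSums.

(** * Sums over integer windows *)

Lemma mem_zwin q (c : int) : (c \in zwin q) = (- (q ^ 2)%N%:Z <= c <= (q ^ 2)%N%:Z).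
Proof.
apply/mapP/andP => [[i + ->]|[lo hi]]; first by rewrite mem_iota; lia.
exists (absz (c + (q ^ 2)%N%:Z)); last by lia.
by rewrite mem_iota; lia.
Qed.

Lemma uniq_zwin q : uniq (zwin q).
Proof. by rewrite map_inj_uniq ?iota_uniq // => i j /addIr[]. Qed.

Lemma sum_zwin q (P : pred int) (l : seq int) (f : int -> int) :
  uniq l -> {subset l <= zwin q} -> {in zwin q, forall s, P s = (s \in l)} ->
  \sum_(s <- zwin q | P s) f s = \sum_(s <- l) f s.
Proof.
move=> l_uniq l_sub Pl; rewrite -big_filter; apply: perm_big.
apply: uniq_perm; rewrite ?filter_uniq ?uniq_zwin // => s.
rewrite mem_filter; have [sw|nsw] := boolP (s \in zwin q); first by rewrite Pl // andbT.
by rewrite andbF; apply/esym/negP => /l_sub; apply/negP.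
Qed.

(** Meant for windows containing at most one integer: [c] is the candidate left by the unit-length
    bounds, and [b] says whether the remaining bounds admit it. *)
Lemma sum_zwin1 q (P : pred int) (c : int) (b : bool) (f : int -> int) :
  (b -> c \in zwin q) -> {in zwin q, forall s, P s = b && (s == c)} ->
  \sum_(s <- zwin q | P s) f s = if b then f c else 0.
Proof.
move=> cb Pb; rewrite (sum_zwin (l := if b then [:: c] else [::])) ?fun_if //.
- by case: b {cb Pb}; rewrite ?big_seq1 ?big_nil.
- by case: b {cb Pb}.
- by case: b cb {Pb} => //= cb s; rewrite inE => /eqP ->; apply: cb.
by move=> s sw; rewrite Pb //; case: b {cb Pb} => //=; rewrite inE.
Qed.

(** * Comparing integers with an integer shifted by a fraction in [0, 1) *)

Section FloorBounds.

Variable th : rat.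
Hypothesis th01 : 0 <= th < 1.

Lemma int_lt_frac (m s : int) : (m%:~R + th < s%:~R) = (m < s).
Proof.
case/andP: th01 => th0 th1; apply/idP/idP => [H|].
  by rewrite -(ltr_int rat); apply: le_lt_trans H; rewrite lerDl.
rewrite -lezD1 -(ler_int rat) rmorphD /= => H.
by apply: lt_le_trans H; rewrite ltrD2l.
Qed.

Lemma int_le_frac1 (m s : int) : (s%:~R <= m%:~R + th + 1) = (s <= m + 1).
Proof.
rewrite addrAC (_ : m%:~R + 1 = (m + 1)%:~R :> rat); last by rewrite rmorphD.
by rewrite leNgt int_lt_frac -leNgt.
Qed.

Lemma int_sub_frac_le (m s : int) : (m%:~R - th <= s%:~R) = (m <= s).
Proof. by rewrite lerBlDr leNgt int_lt_frac -leNgt. Qed.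

Lemma int_lt_sub_frac1 (m s : int) : (s%:~R < m%:~R - th + 1) = (s <= m).
Proof.
rewrite addrAC ltrBrDr (_ : m%:~R + 1 = (m + 1)%:~R :> rat); last by rewrite rmorphD.
by rewrite int_lt_frac ltzD1.
Qed.

End FloorBounds.

(** * Evaluation of I, II and III in terms of E and t *)

Section Terms.

Variables (q u v t E : nat).
Hypotheses (q_gt2 : (2 < q)%N) (u_le : (u <= q.-1)%N) (v_le : (v <= q.-1)%N).
Hypotheses (t_lt : (t < q.-1)%N) (E_le : (E <= q)%N).
Hypothesis tE_gt0 : (0 < t + E)%N.
Hypothesis nE : (u + v * q = E * q.-1 + t)%N.

Local Notation c i := (shiftbin q t (3 * t) i).

(** The fraction is t/(q-1): u + vq = E(q-1) + t gives u + v = (E-v)(q-1) + t. *)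
Lemma ratioE : exists2 th : rat, 0 <= th < 1 & Defs.ratio q u v = (E%:Z - v%:Z)%:~R + th.
Proof.
exists (t%:R / (q%:R - 1)).
  have q1 : 0 < q%:R - 1 :> rat by rewrite subr_gt0 ltr1n; lia.
  apply/andP; split; first by rewrite divr_ge0 ?ler0n // ltW.
  by rewrite ltr_pdivrMr // mul1r ltrBrDr natr1 ltr_nat; lia.
rewrite /Defs.ratio; have q1 : q%:R - 1 != 0 :> rat by rewrite subr_eq0 pnatr_eq1; lia.
apply: (mulIf q1); rewrite mulrDl !divfK //.
have -> : (u + v)%:R = (u%:Z + v%:Z)%:~R :> rat by rewrite natrD rmorphD.
have -> : (q%:R - 1 : rat) = (q%:Z - 1)%:~R by rewrite rmorphB.
have -> : (t%:R : rat) = t%:Z%:~R by [].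
rewrite -intrM -intrD; apply: congr1; nia.
Qed.

Lemma digit_sumE : u%:Z + v%:Z = (E%:Z - v%:Z) * (q%:Z - 1) + t%:Z.
Proof. by nia. Qed.

Lemma sqr_bound : (2 * q <= q ^ 2)%N.
Proof. by rewrite expnS expn1; nia. Qed.

(** The candidate is s = E + 1 - q, which turns the top entry of the binomial into t; the bound -1 <
    s becomes q - 1 <= E. *)
Lemma termIE : termI q u v = (if (q.-1 <= E)%N then c (q.+1 - E) else 0%N)%:Z.
Proof.
have [th th01 rE] := ratioE; have q2 := sqr_bound.
rewrite /termI rE (sum_zwin1 (c := E%:Z + 1 - q%:Z) (b := (q.-1 <= E)%N)).
- case: ifP => // EP; apply: binz_shiftbin; nia.
- by rewrite mem_zwin; lia.
move=> s _.
rewrite (_ : v%:R - q%:R + _ = (E%:Z - q%:Z)%:~R + th); last first.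
  by rewrite !rmorphB /=; ring.
rewrite gt_max int_lt_frac // int_le_frac1 //.
rewrite (_ : -1 = (-1)%:~R :> rat) // ltr_int.
by apply/idP/idP; lia.
Qed.

Lemma termIIE :
  termII q u v = \sum_(i < 3) (if (2 <= E + i <= q)%N then c i else 0%N)%:Z.
Proof.
have [th th01 rE] := ratioE; have q2 := sqr_bound.
(* With s = 2 - i the candidate is alpha = E - 1 + i, and 0 < alpha <= q - 1 reads 2 <= E + i <=
   q. *)
rewrite /termII rE (sum_zwin (l := [seq 2 - i%:Z | i <- iota 0 3])) //.
- rewrite big_map -(big_mkord xpredT (fun i => (if (2 <= E + i <= q)%N then c i else 0%N)%:Z)).
  apply: eq_big_seq => i; rewrite mem_iota => /andP[_ i3] /=.
  rewrite (sum_zwin1 (c := E%:Z - 1 + i%:Z) (b := (2 <= E + i <= q)%N)).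
    - by case: ifP => // EP; apply: binz_shiftbin; nia.
    - by rewrite mem_zwin; lia.
    move=> s _.
    rewrite (_ : v%:R - _ + _ = (E%:Z - 2 + i%:Z)%:~R + th); last first.
      by rewrite !(rmorphB, rmorphD) /=; ring.
    rewrite gt_max int_lt_frac // le_min int_le_frac1 //.
    rewrite (_ : 0 = 0%:~R :> rat) // ltr_int.
    rewrite (_ : q%:R - 1 = (q%:Z - 1)%:~R :> rat); last by rewrite rmorphB.
    rewrite ler_int.
    by apply/idP/idP; lia.
- by move=> s; rewrite mem_zwin /= !inE; lia.
- by move=> s _; rewrite /= !inE; lia.
Qed.

Lemma termIIIE :
  termIII q u v =
  \sum_(i < 3) (if (2 <= E + i <= q)%N then
     (-1) ^+ (E + 1 + i) * (shiftbin q ((t + E).-1 + i) (3 * t) i)%:Z else 0)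
  - (if (q.-1 <= E)%N then c (q.+1 - E) else 0%N)%:Z.
Proof.
have [th th01 rE] := ratioE; have q2 := sqr_bound.
rewrite /termIII rE; congr (_ - _); last first.
  (* This sum equals I: the weaker bound -2 < s adds only E = q - 2, where the shift is 3(q-1) > 3t
     and the binomial vanishes. The bound s <= 1 holds since E <= q. *)
  rewrite (sum_zwin1 (c := E%:Z + 1 - q%:Z) (b := (q.-1 <= E.+1)%N)).
  - case: ifP => EP; last by rewrite ifF //; lia.
    rewrite (binz_shiftbin (q := q) (m := t) (r := 3 * t) (i := q.+1 - E)); try nia.
    case: ifP => // /negbT EP'; rewrite (_ : (q.+1 - E)%N = 3); last by lia.
    by rewrite /shiftbin ifF //; lia.
  - by rewrite mem_zwin; lia.
  move=> s _.
  rewrite (_ : v%:R - q%:R + _ = (E%:Z - q%:Z)%:~R + th); last first.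
    by rewrite !rmorphB /=; ring.
  rewrite gt_max int_lt_frac // le_min int_le_frac1 //.
  rewrite (_ : -2 = (-2)%:~R :> rat) // ltr_int.
  rewrite (_ : 1 = 1%:~R :> rat) // ler_int.
  by apply/idP/idP; lia.
(* With s = 1 - i the candidate is epsilon = s - E + v, and its outer bounds again read 2 <= E + i
   <= q. *)
rewrite (sum_zwin (l := [seq 1 - i%:Z | i <- iota 0 3])) //.
- rewrite big_map -(big_mkord xpredT (fun i => if (2 <= E + i <= q)%N then
    (-1) ^+ (E + 1 + i) * (shiftbin q ((t + E).-1 + i) (3 * t) i)%:Z else 0 : int)).
  apply: eq_big_seq => i; rewrite mem_iota => /andP[_ i3] /=.
  rewrite (sum_zwin1 (c := 1 - i%:Z - (E%:Z - v%:Z)) (b := (2 <= E + i <= q)%N)).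
    - case: ifP => // EP.
      have uE : u%:Z = (E%:Z - v%:Z) * (q%:Z - 1) + t%:Z - v%:Z.
        by rewrite -digit_sumE addrK.
      have mE : ((t + E).-1 + i)%N%:Z = t%:Z + E%:Z - 1 + i%:Z by lia.
      have iE : (i * q.-1)%N%:Z = i%:Z * (q%:Z - 1).
        by rewrite PoszM; congr (_ * _); lia.
      rewrite (binz_shiftbin (q := q) (m := (t + E).-1 + i) (r := 3 * t) (i := i)).
      - congr (_ * _); rewrite -signr_odd -[RHS]signr_odd; congr (_ ^+ nat_of_bool _).
        lia.
      - by rewrite mE uE; ring.
      - by rewrite mE iE PoszM uE; ring.
    - by rewrite mem_zwin; lia.
    move=> s _.
    rewrite (_ : (1 - i%:Z)%:~R - _ = (1 - i%:Z - (E%:Z - v%:Z))%:~R - th); last first.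
      by rewrite !(rmorphB, rmorphD) /=; ring.
    rewrite ge_max int_sub_frac_le // lt_min int_lt_sub_frac1 //.
    rewrite (_ : v%:R - q%:R + 1 = (v%:Z - q%:Z + 1)%:~R :> rat); last first.
      by rewrite rmorphD rmorphB.
    rewrite (_ : v%:R = v%:Z%:~R :> rat) // ler_int ltr_int.
    by apply/idP/idP; lia.
- by move=> s; rewrite mem_zwin /= !inE; lia.
- by move=> s _; rewrite /= !inE; lia.
Qed.

End Terms.

(** * Combining I, II and III *)

Lemma sum_ord3 (V : nmodType) (f : nat -> V) :
  \sum_(i < 3) f i = f 0%N + f 1%N + f 2.
Proof. by rewrite !big_ord_recr big_ord0 /= add0r. Qed.

Lemma shiftbin_small q n r i : (n < r - i * q.-1)%N -> shiftbin q n r i = 0%N.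
Proof. by move=> nr; rewrite /shiftbin; case: ifP => // _; rewrite bin_small. Qed.

(** II and III keep only the indices with 2 <= E + i <= q. The lost differences vanish for E + i <=
    1, while those with E + i > q add up to the doubled term coming from I and from the second sum
    of III. *)
Lemma terms_combined (R : comNzRingType) (q u v t E : nat) :
  [pchar R].-nat q -> odd q -> (2 < q)%N -> (u <= q.-1)%N -> (v <= q.-1)%N ->
  (t < q.-1)%N -> (E <= q)%N -> (0 < t + E)%N -> (u + v * q = E * q.-1 + t)%N ->
  - (termI q u v)%:~R - (termII q u v)%:~R + (termIII q u v)%:~R =
  \sum_(i < 3) (-1) ^+ (E + 1 + i) * (shiftbin q ((t + E).-1 + i) (3 * t) i)%:R
  - \sum_(i < 3) (shiftbin q t (3 * t) i)%:R :> R.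
Proof.
move=> q_pnat q_odd q_gt2 u_le v_le t_lt E_le tE_gt0 nE.
rewrite (@termIE q u v t E) // (@termIIE q u v t E) // (@termIIIE q u v t E) //.
pose a i : R := (-1) ^+ (E + 1 + i) * (shiftbin q ((t + E).-1 + i) (3 * t) i)%:R.
pose c i : R := (shiftbin q t (3 * t) i)%:R.
pose g i := (2 <= E + i <= q)%N.
transitivity (- (if (q.-1 <= E)%N then c (q.+1 - E)%N else 0) *+ 2
    + \sum_(i < 3) if g i then a i - c i else 0).
  pose A := if (q.-1 <= E)%N then c (q.+1 - E)%N else 0.
  transitivity (- A - \sum_(i < 3) (if g i then c i else 0)
      + (\sum_(i < 3) (if g i then a i else 0) - A)).
    have AE : (if (q.-1 <= E)%N then shiftbin q t (3 * t) (q.+1 - E) else 0)%N%:Z%:~R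
      = A by rewrite /A; case: ifP.
    rewrite rmorphB /= AE !rmorph_sum /=; congr (_ - _ + (_ - _)).
      by apply: eq_bigr => i _; rewrite /g; case: ifP.
    apply: eq_bigr => i _; rewrite /g /a; case: ifP => // _.
    by rewrite rmorphM rmorphXn /= rmorphN1.
  have -> : \sum_(i < 3) (if g i then a i - c i else 0) =
      \sum_(i < 3) (if g i then a i else 0) - \sum_(i < 3) (if g i then c i else 0).
    by rewrite -sumrB; apply: eq_bigr => i _; case: ifP; rewrite ?subrr.
  by rewrite -/A; ring.
rewrite (sum_ord3 (fun i => if g i then a i - c i else 0)) (sum_ord3 a) (sum_ord3 c) /=.
have a_d0 i : (E + i = 1)%N -> a i = c i.
  move=> Ei; rewrite /a -addnA [(1 + i)%N]addnC addnA Ei -signr_odd mul1r.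
  by rewrite (_ : (t + E).-1 + i = t)%N //; lia.
have sgq k : (E + k = q.+1)%N -> a k = - (shiftbin q (q + t) (3 * t) k)%:R.
  move=> Ek; rewrite /a (_ : E + 1 + k = q.+2)%N; last by lia.
  rewrite -signr_odd /= negbK q_odd expr1 mulN1r.
  by rewrite (_ : (t + E).-1 + k = q + t)%N //; lia.
have [E0|[E1|[Emid|[Eq1|Eq]]]] :
    E = 0%N \/ E = 1%N \/ (2 <= E <= q.-2)%N \/ (E = q.-1 /\ 2 <= E)%N \/ E = q by lia.
- have [-> -> -> ->] : [/\ (q.-1 <= E)%N = false, g 0%N = false, g 1%N = false & g 2 = true].
    by rewrite /g; split; lia.
  rewrite (a_d0 1%N); last by lia.
  have -> : a 0%N = 0 by rewrite /a shiftbin_small ?mulr0 //; lia.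
  have -> : c 0%N = 0 by rewrite /c shiftbin_small //; lia.
  by ring.
- have [-> -> -> ->] : [/\ (q.-1 <= E)%N = false, g 0%N = false, g 1%N = true & g 2 = true].
    by rewrite /g; split; lia.
  by rewrite (a_d0 0%N); [ring | lia].
- have [-> -> -> ->] : [/\ (q.-1 <= E)%N = false, g 0%N = true, g 1%N = true & g 2 = true].
    by rewrite /g; split; lia.
  by ring.
- have [-> -> -> ->] : [/\ (q.-1 <= E)%N = true, g 0%N = true, g 1%N = true & g 2 = false].
    by rewrite /g; split; lia.
  rewrite (_ : q.+1 - E = 2)%N; last by lia.
  rewrite (sgq 2); last by lia.
  have -> : (shiftbin q (q + t) (3 * t) 2)%:R = c 2.
    rewrite /c /shiftbin; case: ifP => // le.
    by rewrite (bin_frobenius q_pnat) ifF ?addr0 //; lia.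
  by ring.
- have [-> -> -> ->] : [/\ (q.-1 <= E)%N = true, g 0%N = true, g 1%N = false & g 2 = false].
    by rewrite /g; split; lia.
  rewrite (_ : q.+1 - E = 1)%N; last by lia.
  rewrite (sgq 1%N); last by lia.
  have -> : a 2 = (shiftbin q (q + t.+1) (3 * t) 2)%:R.
    rewrite /a (_ : E + 1 + 2 = q.+3)%N; last by lia.
    rewrite -signr_odd /= !negbK q_odd mul1r.
    by rewrite (_ : (t + E).-1 + 2 = q + t.+1)%N //; lia.
  (* For E = q two indices are lost. The Frobenius overflow C(t, 3t-2(q-1)-1) of the i = 1 term
     cancels the extra Pascal term of the i = 2 one. *)
  suff : (shiftbin q (q + t.+1) (3 * t) 2)%:R - (shiftbin q (q + t) (3 * t) 1)%:R
      = c 2 - c 1%N by move=> H; rewrite -[RHS]addr0 -(subrr (c 2 - c 1%N)) -{1}H; ring.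
  rewrite /c /shiftbin !mul1n.
  case: (leqP q.-1 (3 * t)) => le1; last first.
    by rewrite (_ : (2 * q.-1 <= 3 * t)%N = false) //; lia.
  rewrite (bin_frobenius q_pnat).
  case: (leqP (2 * q.-1) (3 * t)) => le2; last first.
    by rewrite (_ : (q <= _)%N = false) ?addr0 //; lia.
  rewrite (bin_frobenius q_pnat) [(q <= 3 * t - 2 * q.-1)%N]leqNgt.
  rewrite (_ : (3 * t - 2 * q.-1 < q)%N) /= ?addr0; last by lia.
  have [k0|k_gt0] := posnP (3 * t - 2 * q.-1).
    by rewrite k0 !bin0 ifF ?addr0 //; lia.
  rewrite ifT; last by lia.
  rewrite -{1}(prednK k_gt0) binS (prednK k_gt0) natrD.
  rewrite (_ : (3 * t - 2 * q.-1).-1 = 3 * t - q.-1 - q)%N; last by lia.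
  by ring.
Qed.

(** * The sum of cubes *)

Lemma sqr_sub1 q : (q ^ 2 - 1 = q.+1 * q.-1)%N.
Proof. by case: q => // q; rewrite -{2}(exp1n 2) subn_sqr subn1 addn1 mulnC. Qed.

Theorem theorem4p5 (F : finFieldType) (q n u v u' v' : nat) :
  #|F| = q -> odd q ->
  (1 <= n <= q ^ 2 - 2)%N ->
  n = (u + v * q)%N -> (u <= q - 1)%N -> (v <= q - 1)%N ->
  (u' <= q - 1)%N -> (v' <= q - 1)%N -> (0 < u' + v' * q)%N ->
  (3 * n = u' + v' * q %[mod q ^ 2 - 1])%N ->
  \sum_(a : F) (map_poly intr (rdickson n) : {poly F}).[a] ^+ 3 =
    3 * (- (deltan q n)%:R - (termI q u v)%:~R - (termII q u v)%:~R
         + (termIII q u v)%:~R)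
    + (if (u' + v' * q <= q ^ 2 - 2)%N then
         - (2%:R^-1) ^+ (u' + v') * ('C(u' + v', q - 1))%:R
         + ('C(2 * (q - 1) - u' - v', q - 1 - u'))%:R
       else -1).
Proof.
move=> qE q_odd; have q_pnat := card_finField_pnat F; rewrite qE in q_pnat.
have q_gt1 : (1 < q)%N by rewrite -qE; exact: finNzRing_gt1.
have q_gt2 : (2 < q)%N by case: q q_odd q_gt1 {qE q_pnat} => [|[|[|]]].
rewrite !subn1 -[(q ^ 2).-1]subn1 => /andP[n_gt0 n_le] nE u_le v_le u'_le v'_le m_gt0 mE.
set t := (n %% q.-1)%N; set E := (n %/ q.-1)%N.
have t_lt : (t < q.-1)%N by rewrite ltn_mod; lia.
have ntE : n = (E * q.-1 + t)%N by exact: divn_eq.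
have E_le : (E <= q)%N.
  by rewrite -ltnS ltn_divLR -?sqr_sub1; lia.
have tE_gt0 : (0 < t + E)%N.
  rewrite lt0n addn_eq0; apply/negP => /andP[/eqP t0 /eqP E0].
  by move: n_gt0; rewrite ntE t0 E0.
have sumF2 : \sum_(x : F) x ^+ (2 * n) * (1 - x) ^+ n =
    - (deltan q n)%:R - \sum_(i < 3) (shiftbin q t (3 * t) i)%:R.
  by rewrite sum_expf_bimonomial ?qE // /deltan subn1.
have two0 : 2%:R != 0 :> F.
  apply/eqP => two0; have /eqP := natr_card_finField F.
  rewrite qE -(odd_double_half q) q_odd natrD -muln2 natrM two0 mulr0 addr0.
  by rewrite oner_eq0.
have two1 : 2%:R ^+ q.-1 = 1 :> F by rewrite -qE expf_card_pred.
set m := (u' + v' * q)%N in m_gt0 mE *.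
(* As q - 1 divides q^2 - 1, it divides 3n exactly when it divides m. *)
have sumF1 : \sum_(x : F) x ^+ (3 * n) = - (q.-1 %| m)%N%:R.
  rewrite sum_expf qE muln_gt0 n_gt0 /=; congr (- (nat_of_bool _)%:R).
  have dvd : (q.-1 %| q ^ 2 - 1)%N by rewrite sqr_sub1 dvdn_mull.
  by rewrite /dvdn -(modn_dvdm (3 * n) dvd) mE modn_dvdm.
have [K [iota _]] := countable_algebraic_closure F.
have [rs rsE] : exists rs : seq K, 'X^#|F| + 'X - 1 = \prod_(x <- rs) ('X - x%:P).
  have [rs rsE] := closed_field_poly_normal ('X^#|F| + 'X - 1 : {poly K}).
  exists rs; rewrite {1}rsE; suff -> : lead_coef ('X^#|F| + 'X - 1 : {poly K}) = 1.
    by rewrite scale1r.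
  rewrite -addrA lead_coefDl ?lead_coefXn // size_polyXn qE.
  apply: leq_ltn_trans (size_polyD _ _) _.
  by rewrite size_polyN size_polyX size_poly1; lia.
have qF_odd : odd #|F| by rewrite qE.
have [r rE] := dickson_root iota.
pose f (x : K) := x ^+ (3 * n) + 3 * (x ^+ (2 * n) * (1 - x) ^+ n).
apply: (fmorph_inj iota); rewrite rmorph_sum /=.
transitivity (\sum_a (f (r a) + f (1 - r a))).
  apply: eq_bigr => a _; rewrite rmorphXn /= (rmorph_rdickson n (rE a)) /f.
  by rewrite subKr ![(_ * n)%N]mulnC !exprM; ring.
rewrite (sum_dickson_roots qF_odd rsE f rE) /f !big_split /= -!mulr_sumr.
rewrite (trace_one_sum_bimonomial iota qF_odd rsE) ?qE ?n_gt0 //.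
rewrite (eq_big_seq (fun x => x ^+ m)) => [|x xrs]; last first.
  by apply: (trace_one_expr_mod iota qF_odd rsE xrs); rewrite qE.
have := trace_one_sum_digits iota qF_odd rsE (u := u') (v := v').
rewrite qE -/m => ->; rewrite ?subn1 //.
(* From here each piece is written as an image under [iota], so that the identity can be pulled back
   to F. *)
have -> : \sum_a (iota a) ^+ (3 * n) = iota (- (q.-1 %| m)%N%:R).
  by rewrite -sumF1 rmorph_sum; apply: eq_bigr => a _; rewrite rmorphXn.
have -> : \sum_a (iota a) ^+ (2 * n) * (1 - iota a) ^+ n =
    iota (- (deltan q n)%:R - \sum_(i < 3) (shiftbin q t (3 * t) i)%:R).
  rewrite -sumF2 rmorph_sum; apply: eq_bigr => a _.
  by rewrite rmorphM !rmorphXn rmorphB rmorph1.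
have -> : \sum_(i < 3) (-1) ^+ (E + 1 + i) * (shiftbin q ((t + E).-1 + i) (3 * t) i)%:R
    = iota (\sum_(i < 3) (-1) ^+ (E + 1 + i) * (shiftbin q ((t + E).-1 + i) (3 * t) i)%:R).
  rewrite rmorph_sum; apply: eq_bigr => i _.
  by rewrite rmorphM rmorphXn rmorphN1 rmorph_nat.
have comb := @terms_combined F q u v t E q_pnat q_odd q_gt2 u_le v_le t_lt E_le tE_gt0.
have -> : (if (m <= q ^ 2 - 2)%N then 'C(2 * q.-1 - u' - v', q.-1 - u')%:R else 0) =
  iota (if (m <= q ^ 2 - 2)%N then 'C(2 * q.-1 - u' - v', q.-1 - u')%:R else 0).
  by case: ifP; rewrite ?rmorph_nat ?rmorph0.
have -> : (3 : K) = iota 3 by rewrite rmorph_nat.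
rewrite -!rmorphM -!rmorphD /=; congr (iota _).
have {}comb := comb (etrans (esym nE) ntE).
rewrite -!addrA [- (termI q u v)%:~R + _]addrA comb.
have -> : (if (m <= q ^ 2 - 2)%N then - 2%:R^-1 ^+ (u' + v') * 'C(u' + v', q.-1)%:R
      + 'C(2 * q.-1 - u' - v', q.-1 - u')%:R else -1) =
   - (q.-1 %| m)%N%:R +
   (if (m <= q ^ 2 - 2)%N then 'C(2 * q.-1 - u' - v', q.-1 - u')%:R else 0) :> F.
  case: ifPn => [m_le|m_gt]; last first.
    (* Here m must be q^2 - 1, a multiple of q - 1, so the indicator supplies the value -1. *)
    have m_le : (m <= q.-1 + q.-1 * q)%N by rewrite leq_add // leq_mul2r v'_le orbT.
    have qq : (q.-1 + q.-1 * q = q ^ 2 - 1)%N by rewrite sqr_sub1 mulSn mulnC.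
    rewrite addr0 (_ : m = q ^ 2 - 1)%N; last by rewrite qq in m_le; lia.
    by rewrite sqr_sub1 dvdn_mull.
  congr (_ + _).
  (* The powers of 2 and 1/2 cancel, leaving the indicator of q - 1 dividing u' + v', which is
     congruent to m modulo q - 1. *)
  rewrite (half_exp_bin q_pnat _ two1); last first.
    by apply/andP; split; move: m_gt0 m_le; rewrite /m; clear -u'_le v'_le q_gt1; nia.
  rewrite mulrCA mulNr -exprMn mulVf // expr1n mulrN1.
  congr (- (nat_of_bool _)%:R).
  have -> : m = (u' + v' + v' * q.-1)%N.
    by rewrite -addnA -mulnS prednK // ltnW.
  by rewrite [RHS]dvdn_addl // dvdn_mull.
move: (\sum_(i < 3) (-1) ^+ _ * _) (\sum_(i < 3) _) (if _ then _ else _) => A B C.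
by ring.
Qed.
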